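(* Let $\delta>0$ and let $\mu$ be a probability distribution on $\mathbb{R}$ defined by a density function of the form $f=e^{\lambda(x)}$ with $\lambda'(x)$ continuous and decreasing. Then for any integer $n\ge 1$, there is a shift-invariant $n$-sample estimator that is optimal.
   Context: For $\theta\in\mathbb{R}$, $\mu_\theta(A)=\mu(\{x:x+\theta\in A\})$, and $\mu_\theta^n$ is the product measure $\mu_\theta\times\cdots\times\mu_\theta$ on $\mathbb{R}^n$. An $n$-sample estimator is a (Borel) measurable function $e:\mathbb{R}^n\to\mathbb{R}$. Its ($\delta$-)quality is $Q(e)=\inf_{\theta\in\mathbb{R}}\mu_\theta^n(\{\mathbf{x}\in\mathbb{R}^n:|e(\mathbf{x})-\theta|<\delta\})$. It is shift-invariant if $e(x_1+c,\ldots,x_n+c)=e(x_1,\ldots,x_n)+c$ for all $c,x_i\in\mathbb{R}$. It is optimal (for the fixed $\delta$ and $n$) if $Q(e)\ge Q(e')$ for all $n$-sample estimators $e'$. *)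

(* Defs.v *)
From HB Require Import structures.
From mathcomp Require Export all_boot all_order all_algebra.
From mathcomp Require Export all_classical all_reals all_analysis.
From mathcomp Require Export measurable_realfun.

Set Implicit Arguments.
Unset Strict Implicit.
Unset Printing Implicit Defensive.

Import Order.TTheory GRing.Theory Num.Theory.
Import numFieldNormedType.Exports.

Local Open Scope classical_set_scope.
Local Open Scope ring_scope.

Section product_power.
Context d (T : measurableType d) (R : realType).

Definition cons_pair n (p : T * n.-tuple T) : n.+1.-tuple T :=
  [the n.+1.-tuple T of p.1 :: p.2].

Lemma measurable_cons_pair n : measurable_fun setT (@cons_pair n).
Proof. exact: measurable_cons measurable_fst measurable_snd. Qed.

HB.instance Definition _ n :=
  isMeasurableFun.Build _ _ _ _ (@cons_pair n) (@measurable_cons_pair n).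

(* The n-fold product measure P x ... x P on n.-tuple T, whose sigma-algebra
   is the one generated by the coordinates (for T the Borel line, the Borel
   sigma-algebra of R^n). *)
Fixpoint prob_power (P : probability T R) (n : nat) :
    probability (n.-tuple T) R :=
  match n with
  | 0 => dirac [tuple]
  | m.+1 => distribution (P \x prob_power P m)%E (@cons_pair m)
  end.

End product_power.

Section estimators.
Context (R : realType).
Local Notation borelR := (measurableTypeR R).

Definition translation (theta : R) : borelR -> borelR := fun x => x + theta.

Lemma measurable_translation theta : measurable_fun setT (translation theta).
Proof. exact: measurable_funD. Qed.

HB.instance Definition _ theta :=
  isMeasurableFun.Build _ _ _ _ (translation theta)
    (measurable_translation theta).

(* By definition of distribution, shifted mu theta A is
   mu [set x | A (x + theta)]. *)
Definition shifted (mu : probability borelR R) (theta : R) :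
    probability borelR R := distribution mu (translation theta).

Definition estimator (n : nat) := {mfun n.-tuple borelR >-> borelR}.

(* Extended-real-valued, but always in [0, 1]: an infimum of probabilities over
   the nonempty set of all theta. *)
Definition quality (mu : probability borelR R) (delta : R) n
    (e : estimator n) : \bar R :=
  ereal_inf (range (fun theta : R =>
    prob_power (shifted mu theta) n [set x | `|e x - theta| < delta])).

Definition shift_invariant n (e : estimator n) : Prop :=
  forall (c : R) (x : n.-tuple borelR),
    e [tuple tnth x i + c | i < n] = e x + c.

Definition optimal (mu : probability borelR R) (delta : R) n
    (e : estimator n) : Prop :=
  forall e' : estimator n, (quality mu delta e' <= quality mu delta e)%E.

Definition has_density (mu : probability borelR R) (f : R -> R) : Prop :=
  forall A : set borelR, measurable A ->
    mu A = (\int[lebesgue_measure]_(x in A) (f x)%:E)%E.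

End estimators.

(* Main.v *)
From HB Require Import structures.
From mathcomp Require Import ring lra.
Require Import Defs.
Import Order.TTheory GRing.Theory Num.Theory.
Import numFieldNormedType.Exports.

(** Write P_theta for the law of an n-sample from mu translated by theta.

    The estimator.  For a sample x, let L_x(theta) = sum_i lambda(x_i - theta)
    be the log-likelihood of theta ([loglik]).  It is concave because lambda'
    decreases, and it is increasing near -oo and decreasing near +oo because
    exp(lambda) is integrable and n > 0.  The difference
    L_x(t - delta) - L_x(t + delta) is then a continuous nondecreasing function
    of t that takes both signs, and the estimate is its least zero
    ([concave_equal_level]): the center of a window of half-width delta at whose
    two ends the likelihood is the same.  Since L_x is concave, exp(L_x) is
    at least that common value inside the window and at most that outside, so this
    window maximizes the integral of exp(L_x) among all windows of the same
    width ([bathtub_window], [center_window]).  The estimate is at most a exactly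
    when L_x(a + delta) <= L_x(a - delta); this gives measurability and
    shift-invariance.

    Optimality.  A shift-invariant estimator e hits the delta-neighborhood of
    theta with the same probability q under every P_theta.  The competitor e' is
    compared to e by averaging over theta in a long interval [-H, H].  Replacing
    Lebesgue measure on R^n, all P_theta are described by a density
    p(x, theta) = exp(L_x(theta) - L_x(0)) with respect to P_0.  For a set B of
    samples, Tonelli turns the integral over theta of
    P_theta(B and |e' - theta| < delta) into the integral over x in B of the
    window integral of p(x, .) around e'(x), which is at most the one around
    e(x) ([integral_hit_le]).  Take B = {|e| <= H + K}.  On the left, for |theta|
    <= H the set B has P_theta-probability at least 1 - eps when K is large, so
    the integral is at least 2 H (q' - eps) if e' has quality q'.  On the right,
    e in B and |e - theta| < delta force |theta| <= H + K + delta, so the integral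
    is at most 2 (H + K + delta) q.  Letting H tend to infinity and then eps to 0
    gives q' <= q ([worst_hit_prob_le]). *)

Set Implicit Arguments.
Unset Strict Implicit.
Unset Printing Implicit Defensive.

Local Open Scope classical_set_scope.
Local Open Scope ring_scope.

(** * Integration against a density *)

Section change_of_density.
Local Open Scope ereal_scope.
Context d (T : measurableType d) (R : realType).

(** The density [g] is almost everywhere the Radon-Nikodym derivative of [nu], for
    which the change of variables is known. *)
Lemma ge0_integral_density (mu : {sigma_finite_measure set T -> \bar R})
    (nu : {finite_measure set T -> \bar R}) (g f : T -> \bar R) :
  measurable_fun setT g -> (forall x, 0 <= g x) ->
  (forall A, measurable A -> nu A = \int[mu]_(x in A) g x) ->
  measurable_fun setT f -> (forall x, 0 <= f x) ->
  \int[nu]_x f x = \int[mu]_x (f x * g x).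
Proof.
move=> mg g0 nuE mf f0.
have numu : nu `<< mu.
  apply/null_content_dominatesP => A mA muA0.
  by rewrite nuE// null_set_integral//; exact: measurable_funTS.
rewrite -(Radon_Nikodym_SigmaFinite.change_of_variables numu)//.
have idN := Radon_Nikodym_SigmaFinite.f_integrable numu.
apply: ae_eq_integral => //.
- by apply: emeasurable_funM => //; exact: measurable_int idN.
- exact: emeasurable_funM.
- apply: ae_eqe_mul2l; apply: integral_ae_eq => //= A _ mA.
  by rewrite -nuE// -Radon_Nikodym_SigmaFinite.f_integral.
Qed.

End change_of_density.

(** * Translation invariance of Lebesgue measure *)

Section lebesgue_translation.
Context (R : realType).
Local Notation borelR := (measurableTypeR R).

Lemma lebesgue_measure_translation (c : R) (A : set borelR) : measurable A ->
  lebesgue_measure (translation c @^-1` A) = lebesgue_measure A.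
Proof.
move=> mA; symmetry.
apply: (@lebesgue_measure_unique R (pushforward lebesgue_measure (translation c))) => //.
move=> X [[a b] _ <-] /=; rewrite /pushforward.
rewrite (_ : translation c @^-1` _ = `]a - c, b - c]%classic); last first.
  by apply/seteqP; split=> x /=; rewrite !in_itv/= /translation ltrBlDr lerBrDr.
rewrite [LHS]lebesgue_measure_itv [RHS]lebesgue_measure_itv /= !lte_fin ltrD2r.
by case: ifP => // _; rewrite -!EFinD; congr EFin; rewrite opprB addrA subrK.
Qed.

Lemma ge0_integral_translation (c : R) (f : borelR -> \bar R) :
  measurable_fun setT f -> (forall x, 0 <= f x)%E ->
  (\int[lebesgue_measure]_x f (x + c)%R = \int[lebesgue_measure]_x f x)%E.
Proof.
move=> mf f0.
have := @ge0_integral_pushforward _ _ _ _ _ _ (measurable_translation c)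
  lebesgue_measure setT f measurableT mf (fun x _ => f0 x).
rewrite preimage_setT => <-.
apply: eq_measure_integral => A mA _.
exact: lebesgue_measure_translation.
Qed.

End lebesgue_translation.

(** * Powers of a probability: densities and images *)

Section prob_power_theory.
Context (R : realType).
Local Open Scope ereal_scope.

Lemma ge0_integral_prob_powerS d (T : measurableType d) (P : probability T R) n
    (h : n.+1.-tuple T -> \bar R) :
  measurable_fun setT h -> (forall x, 0 <= h x) ->
  \int[prob_power P n.+1]_x h x =
  \int[P]_a \int[prob_power P n]_z h (cons_pair (a, z)).
Proof.
move=> mh h0 /=.
rewrite ge0_integral_distribution// fubini_tonelli1//; last first.
  by move=> p; exact: h0.
by apply: measurableT_comp => //; exact: measurable_cons_pair.
Qed.

Lemma ge0_integral_prob_power_density d (T : measurableType d)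
    (P P' : probability T R) (g : T -> R) :
  measurable_fun setT g -> (forall x, 0 <= g x)%R ->
  (forall A, measurable A -> P' A = \int[P]_(x in A) (g x)%:E) ->
  forall n (h : n.-tuple T -> \bar R),
  measurable_fun setT h -> (forall x, 0 <= h x) ->
  \int[prob_power P' n]_x h x =
  \int[prob_power P n]_x (h x * (\prod_(i < n) g (tnth x i))%:E).
Proof.
move=> mg g0 P'E; elim=> [|n IHn] h mh h0.
  by apply: eq_integral => x _; rewrite big_ord0 mule1.
have mG m : measurable_fun setT
    (fun x : m.-tuple T => (\prod_(i < m) g (tnth x i))%:E).
  apply/measurable_EFinP/measurable_prod => i _.
  by apply: measurableT_comp => //; exact: measurable_tnth.
have G0 m (x : m.-tuple T) : 0 <= (\prod_(i < m) g (tnth x i))%:E.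
  by rewrite lee_fin; apply: prodr_ge0.
rewrite !ge0_integral_prob_powerS//; last 2 first.
- exact: (emeasurable_funM mh (mG _)).
- by move=> x; rewrite mule_ge0.
have mcons : measurable_fun setT (fun p : T * n.-tuple T => h (cons_pair p)).
  by apply: measurableT_comp => //; exact: measurable_cons_pair.
have mhG : measurable_fun setT (fun p : T * n.-tuple T =>
    h (cons_pair p) * (\prod_(i < n) g (tnth p.2 i))%:E).
  exact: (emeasurable_funM mcons (measurableT_comp (mG n) measurable_snd)).
transitivity (\int[P']_a \int[prob_power P n]_z
    (h (cons_pair (a, z)) * (\prod_(i < n) g (tnth z i))%:E)).
  apply: eq_integral => a _; apply: IHn => //.
  by apply: (measurableT_comp mcons); exact: measurable_pair1.
rewrite (@ge0_integral_density _ _ _ P P' (EFin \o g))//; last 3 first.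
- exact/measurable_EFinP.
- apply: (measurable_fun_fubini_tonelli_F (fun p : T * n.-tuple T =>
    h (cons_pair p) * (\prod_(i < n) g (tnth p.2 i))%:E)) => // p.
  by rewrite mule_ge0.
- by move=> a; apply: integral_ge0 => z _; rewrite mule_ge0.
apply: eq_integral => a _.
rewrite /= -ge0_integralZr//; last 3 first.
- apply: (measurableT_comp mhG); exact: measurable_pair1.
- by move=> z _; apply: mule_ge0; [exact: h0|exact: G0].
- exact: g0.
apply: eq_integral => z _.
rewrite -muleA -EFinM big_ord_recl; congr (_ * _%:E).
rewrite mulrC; congr (_ * _)%R.
by apply: eq_bigr => i _; rewrite tnthS.
Qed.

Lemma ge0_integral_prob_power_distribution d d' (T : measurableType d)
    (T' : measurableType d') (P : probability T R) (phi : {mfun T >-> T'}) n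
    (h : n.-tuple T' -> \bar R) :
  measurable_fun setT h -> (forall x, 0 <= h x) ->
  \int[prob_power (distribution P phi) n]_x h x =
  \int[prob_power P n]_x h (map_tuple phi x).
Proof.
have mmap m : measurable_fun setT (@map_tuple m _ _ phi).
  apply/measurable_fun_tnthP => i.
  rewrite (_ : _ \o _ = phi \o (@tnth m T ^~ i)); last first.
    by apply/funext => x /=; rewrite tnth_map.
  by apply: measurableT_comp => //; exact: measurable_tnth.
elim: n h => [|n IHn] h mh h0.
  rewrite /= !integral_dirac//; last exact: (measurableT_comp mh (mmap 0%N)).
  by rewrite !diracT !mul1e [map_tuple _ _]tuple0.
have mcons : measurable_fun setT (fun p : T' * n.-tuple T' => h (cons_pair p)).
  by apply: measurableT_comp => //; exact: measurable_cons_pair.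
rewrite !ge0_integral_prob_powerS//; last exact: (measurableT_comp mh (mmap n.+1)).
rewrite ge0_integral_distribution; last 2 first.
- apply: (measurable_fun_fubini_tonelli_F (h \o @cons_pair _ _ n)) => // p.
  exact: h0.
- by move=> a; apply: integral_ge0.
apply: eq_integral => a _ /=.
rewrite IHn//.
- by apply: eq_integral => z _; congr h; apply: val_inj.
- by apply: (measurableT_comp mcons); exact: measurable_pair1.
Qed.

End prob_power_theory.

(** * Comparing estimators by averaging over the parameter *)

Lemma measurable_norm_lt (R : realType) d (T : measurableType d)
    (e : T -> measurableTypeR R) (c : R) :
  measurable_fun setT e -> measurable [set x | `|e x| < c].
Proof.
move=> me; rewrite -[X in measurable X]setTI.
by apply: (@measurable_fun_ltr _ _ _ setT) => //; exact: measurableT_comp.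
Qed.

Lemma measurable_error_lt (R : realType) d (T : measurableType d)
    (e : T -> measurableTypeR R) (t c : R) :
  measurable_fun setT e -> measurable [set x | `|e x - t| < c].
Proof.
move=> me; apply: (@measurable_norm_lt _ _ _ (fun x => e x - t)).
exact: measurable_funB.
Qed.

Lemma measurable_error_gt (R : realType) d (T : measurableType d)
    (e : T -> measurableTypeR R) (t c : R) :
  measurable_fun setT e -> measurable [set x | c < `|e x - t|].
Proof.
move=> me; rewrite -[X in measurable X]setTI.
apply: (@measurable_fun_ltr _ _ _ setT) => //.
by apply: measurableT_comp => //; exact: measurable_funB.
Qed.

Section averaging.
Context (R : realType) d (T : measurableType d).
Local Notation borelR := (measurableTypeR R).
Local Notation leb := (@lebesgue_measure R).
Variables (P : R -> probability T R) (Q : probability T R) (p : T * borelR -> R) (delta : R).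
Hypothesis mp : measurable_fun setT p.
Hypothesis p0 : forall z, 0 <= p z.
Hypothesis pE : forall theta A, measurable A ->
  P theta A = (\int[Q]_(x in A) (p (x, theta))%:E)%E.

Implicit Types (B : set T) (e : T -> borelR).

Let hit (e : T -> borelR) : set (T * borelR) := [set z | `|e z.1 - z.2| < delta].

Let measurable_hit e : measurable_fun setT e -> measurable (hit e).
Proof.
move=> me; rewrite -[hit e]setTI.
apply: (@measurable_fun_ltr _ _ _ setT) => //.
apply: measurableT_comp => //; apply: measurable_funB => //.
exact: measurableT_comp.
Qed.

Let window (e : T -> borelR) (x : T) : \bar R :=
  (\int[leb]_(theta in [set theta : borelR | (`|e x - theta| < delta)%R])
     (p (x, theta))%:E)%E.

(* The integrand on the product of samples and parameters whose two iterated
   integrals are exchanged. *)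
Let F (B : set T) (e : T -> borelR) (z : T * borelR) : \bar R :=
  (\1_B z.1 * \1_(hit e) z * p z)%:E.

Let measurable_F B e : measurable B -> measurable_fun setT e ->
  measurable_fun setT (F B e).
Proof.
move=> mB me; apply/measurable_EFinP/measurable_funM => //.
apply: measurable_funM; last by apply: measurable_indic; exact: measurable_hit.
by apply: measurableT_comp => //; exact: measurable_indic.
Qed.

Let F_ge0 B e z : (0 <= F B e z)%E.
Proof. by rewrite lee_fin !mulr_ge0. Qed.

Let mem_hit e x theta :
  (theta \in [set t : borelR | `|e x - t| < delta]) = ((x, theta) \in hit e).
Proof. by apply/idP/idP; rewrite !inE. Qed.

Let PF B e : measurable B -> measurable_fun setT e ->
  (fun theta => P theta (B `&` [set x | `|e x - theta| < delta])) =
  fubini_G Q (F B e).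
Proof.
move=> mB me; apply/funext => theta; rewrite /fubini_G.
rewrite pE; last first.
  apply: measurableI => //.
  have := measurable_ysection theta (measurable_hit me).
  by rewrite ysectionE.
rewrite [LHS]integral_mkcond; apply: eq_integral => x _.
rewrite /F patchE /= !indicE in_setI.
rewrite (_ : (x \in [set x0 | `|e x0 - theta| < delta]) =
  ((x, theta) \in hit e)); last by apply/idP/idP; rewrite !inE.
by do 2!case: (_ \in _); rewrite ?mul1r ?mul0r.
Qed.

Let windowF B e : window e \_ B = fubini_F leb (F B e).
Proof.
apply/funext => x; rewrite patchE /window /fubini_F /F /=; case: ifPn => xB.
  rewrite [LHS]integral_mkcond; apply: eq_integral => theta _.
  rewrite patchE !indicE xB mul1r mem_hit.
  by case: (_ \in _); rewrite ?mul1r ?mul0r.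
by symmetry; apply: integral0_eq => theta _; rewrite indicE (negbTE xB) !mul0r.
Qed.

Let measurable_window e : measurable_fun setT e ->
  measurable_fun setT (window e).
Proof.
move=> me; rewrite -[window e](patch_setT (fun=> 0%E)) windowF.
by apply: measurable_fun_fubini_tonelli_F => //; exact: measurable_F.
Qed.

Let measurable_prob_hit B e : measurable B -> measurable_fun setT e ->
  measurable_fun setT
    (fun theta : borelR => P theta (B `&` [set x | `|e x - theta| < delta])).
Proof.
move=> mB me; rewrite PF//.
by apply: measurable_fun_fubini_tonelli_G => //; exact: measurable_F.
Qed.

Lemma integral_window (B : set T) (e : T -> borelR) :
  measurable B -> measurable_fun setT e ->
  (\int[leb]_theta P theta (B `&` [set x | (`|e x - theta| < delta)%R]) =
   \int[Q]_(x in B) window e x)%E.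
Proof.
move=> mB me; rewrite PF// [RHS]integral_mkcond windowF.
by rewrite -fubini_tonelli//; exact: measurable_F.
Qed.

Hypothesis delta0 : 0 < delta.
Variables (e e' : T -> borelR).
Hypotheses (me : measurable_fun setT e) (me' : measurable_fun setT e').
Hypothesis e_window : forall x, (window e' x <= window e x)%E.
Hypothesis error_law : forall theta (A : set borelR), measurable A ->
  P theta [set x | A (e x - theta)] = Q [set x | A (e x)].

(** Averaged over the parameter, [e'] cannot hit more often than [e] on any set of
    samples, because for each sample the window around [e] carries more
    likelihood. *)
Lemma integral_hit_le (B : set T) : measurable B ->
  (\int[leb]_theta P theta (B `&` [set x | (`|e' x - theta| < delta)%R]) <=
   \int[leb]_theta P theta (B `&` [set x | (`|e x - theta| < delta)%R]))%E.
Proof.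
move=> mB; rewrite !integral_window//.
apply: ge0_le_integral => //.
- by move=> x _; apply: integral_ge0 => t _; rewrite lee_fin.
- exact/measurable_funTS/measurable_window.
- exact/measurable_funTS/measurable_window.
Qed.

(** The estimation error has the same law under all parameters, so its tails are
    small uniformly in the parameter. *)
Lemma error_tight (eps : R) : 0 < eps -> exists K : R, 0 <= K /\
  forall theta, (P theta [set x | (K < `|e x - theta|)%R] <= eps%:E)%E.
Proof.
move=> eps0.
pose G (k : nat) : set T := [set x | (k%:R < `|e x|)%R].
have mG k : measurable (G k).
  rewrite -[G k]setTI; apply: (@measurable_fun_ltr _ _ _ setT) => //.
  exact: measurableT_comp.
have GP : Q \o G @ \oo --> Q (\bigcap_k G k).
  apply: nonincreasing_cvg_mu => //.
  - by rewrite -ge0_fin_numE//; exact: fin_num_measure.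
  - exact: bigcap_measurable.
  - move=> m n mn; apply/subsetPset => x /=; apply: le_lt_trans.
    by rewrite ler_nat.
have capG : \bigcap_k G k = set0.
  apply/seteqP; split=> // x /(_ (Num.truncn `|e x|).+1 I) /=.
  by move=> /lt_trans /(_ (truncnS_gt _)); rewrite ltxx.
rewrite capG measure0 in GP.
have /GP : nbhs 0%E [set y : \bar R | (y < eps%:E)%E].
  by apply: open_ereal_lt'; rewrite lte_fin.
move=> [k _ /(_ k (leqnn k)) /= Gk].
exists k%:R; split=> // theta.
rewrite (error_law theta (A := [set t : borelR | k%:R < `|t|])); first exact: ltW.
by rewrite -[X in measurable X]setTI; apply: (@measurable_fun_ltr _ _ _ setT).
Qed.

Let ball_itv (c : R) : [set t : borelR | `|t| <= c] = `[- c, c]%classic.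
Proof. by apply/seteqP; split=> t /=; rewrite in_itv/= ler_norml. Qed.

Let lebesgue_ball (c : R) : 0 <= c ->
  leb [set t : borelR | `|t| <= c] = (c *+ 2)%:E.
Proof.
move=> c0; rewrite ball_itv lebesgue_measure_itv/= lte_fin.
case: ltP => cc; first by rewrite -EFinD opprK mulr2n.
by rewrite (_ : c = 0) ?mul0rn//; lra.
Qed.

(** The Lebesgue measure of the parameters is infinite, so [integral_hit_le] is
    applied only to the samples with [`|e x| <= H + K].  For the competitor this
    loses a probability [eps] at each parameter in [[-H, H]]; for [e] it leaves
    the parameters in a range longer by the factor [1 + (K + delta) / H], which
    tends to 1. *)
Lemma worst_hit_prob_le (q' : R) :
  (forall theta, q'%:E <= P theta [set x | (`|e' x - theta| < delta)%R])%E ->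
  (q'%:E <= Q [set x | (`|e x| < delta)%R])%E.
Proof.
move=> hq'.
have qfin : Q [set x | `|e x| < delta] \is a fin_num.
  by apply: fin_num_measure; exact: measurable_norm_lt.
rewrite -(fineK qfin) lee_fin leNgt; apply/negP.
set q := fine _ => qq'.
have qE theta : P theta [set x | `|e x - theta| < delta] = q%:E.
  rewrite (error_law theta (A := [set t : borelR | `|t| < delta])).
    by rewrite /q fineK.
  exact: measurable_norm_lt.
have q0 : 0 <= q by exact: fine_ge0.
(* The bounds below give (q + eps) * H <= q * (H + C), and H is chosen so that
   eps * H > C * q. *)
pose eps := (q' - q) / 2.
have eps0 : 0 < eps by rewrite /eps; lra.
have [K [K0 tightK]] := error_tight eps0.
pose C := K + delta.
pose H := (C * q + 1) / eps.
have H0 : 0 < H by rewrite divr_gt0// ltr_wpDl// mulr_ge0// /C addr_ge0// ltW.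
pose B : set T := [set x | `|e x| <= H + K].
have mB : measurable B.
  rewrite -[B]setTI; apply: (@measurable_fun_ler _ _ _ setT) => //.
  exact: measurableT_comp.
have mball c : measurable [set t : borelR | `|t| <= c].
  by rewrite ball_itv; exact: measurable_itv.
have lower : ((q' - eps)%:E * leb [set t : borelR | (`|t| <= H)%R] <=
    \int[leb]_theta P theta (B `&` [set x | (`|e' x - theta| < delta)%R]))%E.
  rewrite -integral_cst// [leLHS]integral_mkcond; apply: ge0_le_integral => //.
  - move=> t _; rewrite patchE; case: ifP => // _; rewrite lee_fin /eps; lra.
  - by apply/measurable_restrict => //; apply: measurable_cst.
  - exact: measurable_prob_hit.
  - move=> t _; rewrite patchE; case: ifPn => [/[!inE] /= tH|_]; last exact: measure_ge0.
    rewrite EFinB leeBlDr//.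
    apply: le_trans (hq' t) _.
    apply: le_trans (leeD2l _ (tightK t)).
    have mK := measurable_error_gt t K me.
    have mh := measurable_error_lt t delta me'.
    apply: le_trans (measureU2 _ _ mK); last exact: measurableI.
    apply: le_measure; rewrite ?inE//; first by apply: measurableU => //; exact: measurableI.
    move=> x /= hx; have [xK|] := ltP K `|e x - t|; first by right.
    move=> xK; left; split=> //; rewrite /B /=.
    rewrite -[e x](subrK t) (le_trans (ler_normD _ _))// addrC lerD//.
have upper : (\int[leb]_theta P theta (B `&` [set x | (`|e x - theta| < delta)%R])
    <= q%:E * leb [set t : borelR | (`|t| <= H + C)%R])%E.
  rewrite -integral_cst// [leRHS]integral_mkcond; apply: ge0_le_integral => //.
  - exact: measurable_prob_hit.
  - by apply/measurable_restrict => //; apply: measurable_cst.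
  - move=> t _; rewrite patchE; case: ifPn => tH.
      rewrite -(qE t); apply: le_measure; rewrite ?inE//.
        by apply: measurableI => //; exact: measurable_error_lt.
      exact: measurable_error_lt.
    (* a sample in B cannot hit a parameter beyond H + K + delta *)
    rewrite (_ : _ `&` _ = set0) ?measure0//.
    apply/seteqP; split=> // x [xB /= ex].
    move: tH; rewrite notin_setE /= => /negP; apply/negP; rewrite negbK.
    rewrite -[t](subKr (e x)) (le_trans (ler_normB _ _))//.
    by rewrite /C addrA lerD// ltW.
have := le_trans lower (le_trans (integral_hit_le mB) upper).
rewrite !lebesgue_ball ?(ltW H0)//; last first.
  by rewrite !addr_ge0// ltW.
rewrite -!EFinM lee_fin.
have epsH : eps * H = C * q + 1 by rewrite /H mulrC divfK// gt_eqF.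
rewrite [q' - eps](_ : _ = q + eps); last by rewrite /eps; lra.
rewrite mulrDl !mulr2n !mulrDr.
move: epsH; rewrite /C mulrDl; lra.
Qed.

End averaging.

(** * Windows under a concave function *)

(** The least zero is the infimum of the points where [h] is nonnegative; if [h]
    were negative there, the intermediate value theorem would give a larger
    point where it is still negative. *)
Lemma nondecreasing_first_zero (R : realType) (h : R -> R) (u v : R) :
  nondecreasing_fun h -> continuous h -> h u < 0 -> 0 < h v ->
  exists z, h z = 0 /\ forall a, (z <= a) = (0 <= h a).
Proof.
move=> ndh ch hu hv.
have uv : u <= v.
  by rewrite leNgt; apply/negP => /ltW /ndh; lra.
have ivt a b w : a <= b -> h a <= w <= h b -> exists2 c, c \in `[a, b] & h c = w.
  move=> ab /andP[aw wb]; apply: IVT => //; first exact: continuous_subspaceT.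
  by rewrite ge_min aw le_max wb orbT.
pose S := [set t | 0 <= h t].
have uS : lbound S u.
  by move=> t; rewrite /S /= => t0; rewrite leNgt; apply/negP => /ltW /ndh; lra.
pose z := inf S.
have zS t : S t -> z <= t by apply: ge_inf; exists u.
have [c cuv hc] : exists2 c, c \in `[u, v] & h c = 0.
  by apply: ivt => //; rewrite !ltW.
have zc : z <= c by apply: zS; rewrite /S /= hc.
have hz0 : h z <= 0 by rewrite -hc; exact: ndh.
have hz : h z = 0.
  apply/eqP; rewrite eq_le hz0 /= leNgt; apply/negP => hzlt.
  have [w] : exists2 w, w \in `[z, c] & h w = h z / 2.
    by apply: ivt => //; rewrite hc; apply/andP; split; lra.
  rewrite in_itv /= => /andP[zw wc] hw.
  suff : w <= z by move=> /ndh; lra.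
  apply: lb_le_inf; first by exists c; rewrite /S /= hc.
  by move=> t; rewrite /S /= => t0; rewrite leNgt; apply/negP => /ltW /ndh; lra.
exists z; split=> // a; apply/idP/idP => [/ndh|]; first by rewrite hz.
exact: zS.
Qed.

(** Here concavity of [h] is the monotonicity of its derivative [dh]. *)
Section concave.
Context (R : realType) (h dh : R -> R).
Hypothesis hD : forall x : R, is_derive x 1 h (dh x).
Hypothesis dh_ni : nonincreasing_fun dh.

Let ch : continuous h.
Proof.
by move=> x; apply: differentiable_continuous; apply/derivable1_diffP.
Qed.

Let chord a b : a < b -> exists c, [/\ a < c, c < b & h b - h a = dh c * (b - a)].
Proof.
move=> ab; have [c] := MVT ab (fun x _ => hD x) (continuous_subspaceT ch).
by rewrite in_itv /= => /andP[ac cb] hc; exists c.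
Qed.

Lemma concave_slopes a b c : a < b -> b < c ->
  (h c - h b) * (b - a) <= (h b - h a) * (c - b).
Proof.
move=> ab bc; have [s [_ sb ->]] := chord ab; have [t [bt _ ->]] := chord bc.
rewrite mulrAC; do 2!(apply: ler_wpM2r; first by rewrite subr_ge0 ltW).
exact/dh_ni/ltW/(lt_trans sb).
Qed.

Lemma concave_increment (k s t : R) : 0 <= k -> s <= t ->
  h (t + k) - h t <= h (s + k) - h s.
Proof.
move=> k0; rewrite le_eqVlt => /orP[/eqP->//|st].
pose g x := h (x + k) - h x.
have gD (x : R) : is_derive x 1 g (dh (x + k) - dh x).
  apply: is_deriveB.
  have -> : dh (x + k) = dh (x + k) * 1 by rewrite mulr1.
  apply: (@is_derive1_comp _ h (fun y => y + k)).
  by rewrite -[X in is_derive _ _ _ X]addr0; apply: is_deriveD.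
have [|y _] := @MVT R g _ s t st (fun x _ => gD x).
  by apply: derivable_within_continuous => x _.
rewrite /g => gst; rewrite -subr_le0 gst.
apply: mulr_le0_ge0; last by rewrite subr_ge0 ltW.
by rewrite subr_le0; apply: dh_ni; rewrite lerDl.
Qed.

Lemma concave_level_inside a b x : h a = h b -> a <= x <= b -> h a <= h x.
Proof.
move=> hab /andP[]; rewrite le_eqVlt => /orP[/eqP->//|ax].
rewrite le_eqVlt => /orP[/eqP->//|xb]; first by rewrite hab.
have := concave_slopes ax xb; rewrite -hab -subr_ge0.
rewrite (_ : _ - _ = (h x - h a) * (b - a)); last by ring.
by rewrite pmulr_lge0 ?subr_ge0 ?subr_gt0// (lt_trans ax).
Qed.

Lemma concave_level_outside a b x : a < b -> h a = h b -> x <= a \/ b <= x ->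
  h x <= h a.
Proof.
move=> ab hab []; rewrite le_eqVlt => /orP[/eqP<-//|xa]; last 2 first.
- by rewrite hab.
- have := concave_slopes ab xa.
  by rewrite hab subrr mul0r pmulr_lle0 ?subr_gt0// subr_le0.
rewrite ?hab//; have := concave_slopes xa ab.
by rewrite hab subrr mul0r pmulr_lge0 ?subr_gt0// subr_ge0.
Qed.

(** The function [t |-> h (t - delta) - h (t + delta)] is nondecreasing because
    increments of [h] decrease, and has both signs because [h] is increasing left
    of [u] and decreasing right of [v].  Its least zero is characterized by an
    order condition that determines it uniquely. *)
Lemma concave_equal_level (delta u v : R) : 0 < delta -> 0 < dh u -> dh v < 0 ->
  exists z, h (z - delta) = h (z + delta) /\
    forall a, (z <= a) = (h (a + delta) <= h (a - delta)).
Proof.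
move=> d0 du dv; pose D t := h (t - delta) - h (t + delta).
have [z [Dz zD]] : exists z, D z = 0 /\ forall a, (z <= a) = (0 <= D a).
  apply: (@nondecreasing_first_zero _ _ (u - delta) (v + delta)).
  - (* D t is minus the increment of h over a step 2 * delta *)
    move=> s t st; rewrite -lerN2 /D !opprB.
    have st' : s - delta <= t - delta by rewrite lerD2r.
    have := concave_increment (mulrn_wge0 2 (ltW d0)) st'.
    by rewrite !mulr2n !addrA !subrK.
  - move=> t; apply: cvgB; apply: continuous_comp; try exact: ch.
      by apply: cvgB; [exact: cvg_id|exact: cvg_cst].
    by apply: cvgD; [exact: cvg_id|exact: cvg_cst].
  - have lt : u - delta - delta < u - delta + delta by lra.
    have [c [_ cu hc]] := chord lt; rewrite /D -opprB hc oppr_lt0.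
    rewrite mulr_gt0//; last by rewrite subr_gt0.
    by apply: (lt_le_trans du); apply: dh_ni; rewrite subrK in cu; exact: ltW.
  - have lt : v + delta - delta < v + delta + delta by lra.
    have [c [cv _ hc]] := chord lt; rewrite /D -opprB hc oppr_gt0.
    rewrite nmulr_rlt0; first by rewrite subr_gt0.
    by apply: le_lt_trans dv; apply: dh_ni; rewrite addrK in cv; exact: ltW.
exists z; split; first exact: subr0_eq.
by move=> a; rewrite zD subr_ge0.
Qed.

End concave.

(** With [W r] the window around [r], [\1_(W t) * g + \1_(W s) * c] is pointwise at
    most [\1_(W s) * g + \1_(W t) * c], and the terms in [c] have the same
    integral since windows have the same length. *)
Lemma bathtub_window (R : realType) (g : measurableTypeR R -> R) (delta c s : R) :
  measurable_fun setT g -> (forall x, 0 <= g x) -> 0 <= c -> 0 < delta ->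
  (forall x, `|s - x| < delta -> c <= g x) ->
  (forall x, delta <= `|s - x| -> g x <= c) ->
  forall t,
  (\int[lebesgue_measure]_(x in [set x : measurableTypeR R | (`|t - x| < delta)%R]) (g x)%:E <=
   \int[lebesgue_measure]_(x in [set x : measurableTypeR R | (`|s - x| < delta)%R]) (g x)%:E)%E.
Proof.
move=> mg g0 c0 d0 cg gc t.
pose W (r : R) : set (measurableTypeR R) := [set x | `|r - x| < delta].
have WE r : W r = `]r - delta, r + delta[%classic.
  by apply/seteqP; split=> x; rewrite /W /= in_itv /= distrC ltr_distl.
have mW r : measurable (W r) by rewrite WE; exact: measurable_itv.
have muW r : lebesgue_measure (W r) = (delta *+ 2)%:E.
  rewrite WE lebesgue_measure_itv /= lte_fin ifT; last by lra.
  by rewrite -EFinD; congr EFin; ring.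
have intc r : (\int[lebesgue_measure]_(x in W r) c%:E)%E = (c * (delta *+ 2))%:E.
  by rewrite integral_cst// EFinM; congr (_ * _)%E; exact: muW.
have sum r r' : (\int[lebesgue_measure]_(x in W r) (g x)%:E + (c * (delta *+ 2))%:E =
  \int[lebesgue_measure]_x (\1_(W r) x * g x + \1_(W r') x * c)%:E)%E.
  rewrite -(intc r') [X in (X + _)%E]integral_mkcond [X in (_ + X)%E]integral_mkcond.
  rewrite -ge0_integralD//.
  - apply: eq_integral => x _; rewrite !patchE !indicE.
    by do 2!case: ifP => _; rewrite ?mul1r ?mul0r -?EFinD ?addr0 ?add0r.
  - by move=> x _; rewrite patchE; case: ifP => // _; rewrite lee_fin.
  - by apply/measurable_restrict => //; apply/measurable_EFinP/measurable_funTS.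
  - by move=> x _; rewrite patchE; case: ifP => // _; rewrite lee_fin.
  - by apply/measurable_restrict => //; apply: measurable_cst.
rewrite -(@leeD2rE _ (c * (delta *+ 2))%:E)// (sum t s) (sum s t).
have mI r r' : measurable_fun setT
    (fun x => (\1_(W r) x * g x + \1_(W r') x * c)%:E).
  apply/measurable_EFinP/measurable_funD; apply: measurable_funM => //;
  exact: measurable_indic.
apply: ge0_le_integral => //.
- by move=> x _; rewrite lee_fin addr_ge0// mulr_ge0.
- move=> x _; rewrite lee_fin !indicE.
  have [xt|xt] := boolP (x \in W t); have [xs|xs] := boolP (x \in W s);
    rewrite ?mul1r ?mul0r ?addr0 ?add0r//.
  + by apply: gc; move: xs; rewrite notin_setE /= => /negP; rewrite -leNgt.
  + by apply: cg; move: xs; rewrite inE.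
Qed.

(** * Translation families given by a density *)

(** Otherwise the interval, of length [2 / c], would have mass at least 2. *)
Lemma density_lt (R : realType) (mu : probability (measurableTypeR R) R)
    (f : R -> R) (c a : R) :
  measurable_fun setT f -> (forall x, 0 <= f x) -> has_density mu f -> 0 < c ->
  exists x, a <= x <= a + 2 / c /\ f x < c.
Proof.
move=> mf f0 muf c0; apply: contrapT => nex.
have cf x : x \in `[a, a + 2 / c] -> c <= f x.
  rewrite in_itv /= => xI; rewrite leNgt; apply/negP => fx.
  by apply: nex; exists x.
pose I : set (measurableTypeR R) := `[a, a + 2 / c]%classic.
have mI : measurable I by exact: measurable_itv.
have c20 : 0 < 2 / c by rewrite divr_gt0.
have : (2%:E <= mu I)%E.
  rewrite muf//.
  have -> : 2%:E =
    (\int[lebesgue_measure]_(x in I) c%:E :> \bar R)%E.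
    rewrite integral_cst//= [X in (_ * X)%E]lebesgue_measure_itv /= lte_fin.
    rewrite ifT ?ltrDl// -EFinD -EFinM; congr EFin.
    by rewrite addrAC subrr add0r mulrC divfK// gt_eqF.
  apply: ge0_le_integral => //.
  - by move=> x _; rewrite lee_fin ltW.
  - exact/measurable_EFinP/measurable_funTS.
have := probability_le1 mu mI => /[swap] /le_trans /[apply].
by rewrite lee_fin; lra.
Qed.

Section location_family.
Context (R : realType) (mu : probability (measurableTypeR R) R) (lambda : R -> R).
Local Notation borelR := (measurableTypeR R).
Hypothesis mlambda : measurable_fun setT lambda.
Hypothesis hmu : has_density mu (fun x => expR (lambda x)).

Let mf : measurable_fun setT (fun x : borelR => expR (lambda x)).
Proof. exact: measurableT_comp. Qed.

(** The density is taken with respect to [mu] instead of Lebesgue measure, since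
    powers on tuples are those of a probability; the density of [mu] never
    vanishes, so the quotient makes sense. *)
Lemma shifted_density (theta : R) (A : set borelR) : measurable A ->
  (shifted mu theta A =
   \int[mu]_(x in A) (expR (lambda (x - theta) - lambda x))%:E)%E.
Proof.
move=> mA.
have mr : measurable_fun setT
    (fun x : borelR => (expR (lambda (x - theta) - lambda x))%:E).
  apply/measurable_EFinP/measurableT_comp => //; apply: measurable_funB => //.
  apply: (measurableT_comp mlambda).
  exact: measurable_funB.
rewrite [RHS]integral_mkcond (@ge0_integral_density _ _ _ lebesgue_measure mu
  (fun x => (expR (lambda x))%:E))//; last 3 first.
- exact/measurable_EFinP.
- exact/(measurable_restrictT _ mA)/measurable_funTS.
- by move=> x; rewrite patchE; case: ifP => // _; rewrite lee_fin expR_ge0.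
pose F := (fun x : borelR => (expR (lambda (x - theta)))%:E) \_ A.
have mF : measurable_fun setT F.
  apply/(measurable_restrictT _ mA)/measurable_funTS.
  apply/measurable_EFinP/(measurableT_comp mf).
  exact: measurable_funB.
transitivity (\int[lebesgue_measure]_x F x)%E; last first.
  apply: eq_integral => x _; rewrite /F !patchE; case: ifP => _; last by rewrite mul0e.
  by rewrite -EFinM -expRD subrK.
rewrite -(ge0_integral_translation theta)//; last first.
  by move=> x; rewrite /F patchE; case: ifP => // _; rewrite lee_fin expR_ge0.
rewrite /shifted /= /distribution /pushforward hmu; last first.
  by rewrite -[X in measurable X]setTI; exact: measurable_translation.
rewrite integral_mkcond; apply: eq_integral => x _.
by rewrite /F !patchE addrK; congr (if _ then _ else _); apply/idP/idP; rewrite !inE.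
Qed.

End location_family.

Section loglik.
Context (R : realType) (lambda : R -> R) (n : nat).
Local Notation borelR := (measurableTypeR R).

Definition loglik (x : n.-tuple borelR) (theta : R) : R :=
  \sum_(i < n) lambda (tnth x i - theta).

Definition shift_tuple (c : R) (x : n.-tuple borelR) : n.-tuple borelR :=
  [tuple tnth x i + c | i < n].

Lemma loglik_shift c x theta :
  loglik (shift_tuple c x) theta = loglik x (theta - c).
Proof.
apply: eq_bigr => i _; rewrite tnth_mktuple; congr lambda; rewrite opprB.
by rewrite addrA addrAC.
Qed.

Lemma measurable_loglik : measurable_fun setT lambda ->
  measurable_fun setT (fun z : n.-tuple borelR * borelR => loglik z.1 z.2).
Proof.
move=> ml; apply: measurable_sum => i; apply: (measurableT_comp ml).
apply: measurable_funB => //.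
exact: (measurableT_comp (measurable_tnth i)).
Qed.

Lemma expR_loglik x theta :
  \prod_(i < n) expR (lambda (tnth x i - theta) - lambda (tnth x i)) =
  expR (loglik x theta - loglik x 0).
Proof.
rewrite -expR_sum /loglik -sumrB; congr expR.
by apply: eq_bigr => i _; rewrite subr0.
Qed.

Hypothesis hd : forall x : R, derivable lambda x 1.

Lemma is_derive_loglik x (theta : R) :
  is_derive theta 1 (loglik x) (- \sum_(i < n) derive1 lambda (tnth x i - theta)).
Proof.
have -> : loglik x = \sum_(i < n) (fun t : R => lambda (tnth x i - t)).
  by apply/funext => t; rewrite fct_sumE.
rewrite -sumrN; apply: is_derive_sum => i.
rewrite -mulrN1; apply: (@is_derive1_comp _ lambda (fun t => tnth x i - t)).
  by rewrite derive1E; exact: derivableP.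
rewrite -[X in is_derive _ _ _ X]add0r; apply: is_deriveB.
Qed.

End loglik.

Section sample.
Context (R : realType) (mu : probability (measurableTypeR R) R) (n : nat).
Local Notation borelR := (measurableTypeR R).

Lemma prob_power_shifted (theta : R) (S : set (n.-tuple borelR)) :
  measurable S -> measurable (@shift_tuple R n theta @^-1` S) ->
  prob_power (shifted mu theta) n S =
  prob_power mu n (@shift_tuple R n theta @^-1` S).
Proof.
move=> mS mS0; rewrite -[S in LHS]setIT -integral_indic//.
rewrite -[in RHS](setIT (_ @^-1` S)) -integral_indic//.
rewrite ge0_integral_prob_power_distribution//; last first.
  exact/measurable_EFinP/measurable_indic.
apply: eq_integral => x _; congr EFin.
have -> : map_tuple (translation theta) x = shift_tuple theta x.
  by apply: eq_from_tnth => i; rewrite tnth_map tnth_mktuple.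
by rewrite !indicE; congr (nat_of_bool _)%:R; apply/idP/idP; rewrite !inE.
Qed.

Variable lambda : R -> R.
Hypothesis mlambda : measurable_fun setT lambda.
Hypothesis hmu : has_density mu (fun x => expR (lambda x)).

Lemma prob_power_shifted_density (theta : R) (A : set (n.-tuple borelR)) :
  measurable A ->
  (prob_power (shifted mu theta) n A = \int[prob_power mu n]_(x in A)
    (expR (loglik lambda x theta - loglik lambda x 0))%:E)%E.
Proof.
move=> mA; rewrite -[A in LHS]setIT -integral_indic//.
rewrite (@ge0_integral_prob_power_density _ _ _ mu (shifted mu theta)
  (fun x : borelR => expR (lambda (x - theta) - lambda x)))//.
- rewrite [RHS]integral_mkcond; apply: eq_integral => x _.
  by rewrite patchE indicE expR_loglik; case: ifP => _; rewrite ?mul1e ?mul0e.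
- apply: measurableT_comp => //; apply: measurable_funB => //.
  by apply: (measurableT_comp mlambda); exact: measurable_funB.
- exact: shifted_density.
- exact/measurable_EFinP/measurable_indic.
Qed.

End sample.

(** * The centered estimator and its optimality *)

Section log_concave_density.
Context (R : realType) (mu : probability (measurableTypeR R) R) (lambda : R -> R).
Local Notation borelR := (measurableTypeR R).
Hypothesis hd : forall x : R, derivable lambda x 1.
Hypothesis hni : nonincreasing_fun (derive1 lambda).
Hypothesis hmu : has_density mu (fun x => expR (lambda x)).

Lemma lambda_continuous : continuous lambda.
Proof.
by move=> x; apply: differentiable_continuous; apply/derivable1_diffP.
Qed.

Let mlambda : measurable_fun setT lambda.
Proof. exact: continuous_measurable_fun lambda_continuous. Qed.

Lemma density_small (a : R) :
  exists x, a <= x <= a + 2 / expR (lambda 0) /\ lambda x < lambda 0.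
Proof.
have [x [xI]] := @density_lt R mu _ _ a (measurableT_comp (@measurable_expR R) mlambda)
  (fun x => expR_ge0 _) hmu (expR_gt0 (lambda 0)).
by rewrite ltr_expR => lx; exists x.
Qed.

Lemma lambda_chord a b : a < b ->
  exists2 c, a < c < b & lambda b - lambda a = derive1 lambda c * (b - a).
Proof.
move=> ab.
have D x : is_derive (x : R) 1 lambda (derive1 lambda x).
  by rewrite derive1E; exact: derivableP.
have [c] := MVT ab (fun x _ => D x) (continuous_subspaceT lambda_continuous).
by rewrite in_itv /=; exists c.
Qed.

(** If [lambda] never decreased, the density would be at least its value at 0 on
    the whole half-line of positive reals. *)
Lemma derive_lambda_neg : exists u, derive1 lambda u < 0.
Proof.
have [x [/andP[x0 _] lx]] := density_small 0.
have {}x0 : 0 < x by rewrite lt_neqAle x0 andbT; apply: contraTneq lx => <-; rewrite ltxx.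
have [c _ hc] := lambda_chord x0; exists c.
have : derive1 lambda c * (x - 0) < 0 by rewrite -hc subr_lt0.
by rewrite pmulr_llt0 ?subr_gt0.
Qed.

Lemma derive_lambda_pos : exists u, 0 < derive1 lambda u.
Proof.
have [x [/andP[_ x0] lx]] := density_small (- (2 / expR (lambda 0))).
have {}x0 : x < 0.
  rewrite addNr in x0; rewrite lt_neqAle x0 andbT.
  by apply: contraTneq lx => ->; rewrite ltxx.
have [c _ hc] := lambda_chord x0; exists c.
have : 0 < derive1 lambda c * (0 - x) by rewrite -hc subr_gt0.
by rewrite pmulr_lgt0 ?subr_gt0.
Qed.

Variables (n : nat) (hn : (1 <= n)%N).

Let hasn : has predT (index_enum 'I_n).
Proof. by apply/hasP; exists (Ordinal hn) => //; exact: mem_index_enum. Qed.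

Let dloglik (x : n.-tuple borelR) (theta : R) : R :=
  - \sum_(i < n) derive1 lambda (tnth x i - theta).

Lemma dloglik_nonincreasing x : nonincreasing_fun (dloglik x).
Proof.
move=> s t st; rewrite lerN2; apply: ler_sum => i _.
by apply: hni; rewrite lerD2l lerN2.
Qed.

(* For theta <= - (absum x + |u|) every x_i - theta is at least u, and for
   theta >= absum x + |u| every x_i - theta is at most u. *)
Let absum (x : n.-tuple borelR) : R := \sum_(i < n) `|tnth x i : R|.

Let le_absum x i : `|tnth x i : R| <= absum x.
Proof. by rewrite /absum (bigD1 i)//= lerDl; apply: sumr_ge0. Qed.

Lemma dloglik_pos x : exists theta, 0 < dloglik x theta.
Proof.
have [u u0] := derive_lambda_neg; exists (- (absum x + `|u|)).
rewrite /dloglik oppr_gt0 [ltRHS](_ : 0 = \sum_(i < n) 0); last by rewrite big1.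
apply: ltr_sum => // i _; apply: le_lt_trans u0; apply: hni.
have := le_absum x i; rewrite ler_norml => /andP[].
have := ler_norm u; lra.
Qed.

Lemma dloglik_neg x : exists theta, dloglik x theta < 0.
Proof.
have [u u0] := derive_lambda_pos; exists (absum x + `|u|).
rewrite /dloglik oppr_lt0 [ltLHS](_ : 0 = \sum_(i < n) 0); last by rewrite big1.
apply: ltr_sum => // i _; apply: lt_le_trans u0 _; apply: hni.
have := le_absum x i; rewrite ler_norml => /andP[].
have := ler_norm (- u); rewrite normrN; lra.
Qed.

Variables (delta : R) (hdelta : 0 < delta).

Lemma center_exists (x : n.-tuple borelR) : exists z : borelR,
  loglik lambda x (z - delta) = loglik lambda x (z + delta) /\
  forall a, (z <= a) =
    (loglik lambda x (a + delta) <= loglik lambda x (a - delta)).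
Proof.
have [u hu] := dloglik_pos x; have [v hv] := dloglik_neg x.
exact: (concave_equal_level (is_derive_loglik hd x) (@dloglik_nonincreasing x)
  hdelta hu hv).
Qed.

Let center (x : n.-tuple borelR) : borelR := sval (cid (center_exists x)).

Let center_level x :
  loglik lambda x (center x - delta) = loglik lambda x (center x + delta).
Proof. by rewrite /center; case: cid => z []. Qed.

Let center_le x (a : R) : (center x <= a) =
  (loglik lambda x (a + delta) <= loglik lambda x (a - delta)).
Proof. by rewrite /center; case: cid => z []. Qed.

(* Two reals with the same upper bounds are equal. *)
Let center_shift c x : center (shift_tuple c x) = center x + c.
Proof.
apply/eqP; rewrite eq_le.
have key a : (center (shift_tuple c x) <= a) = (center x + c <= a).
  rewrite -lerBrDr !center_le !loglik_shift.
  by rewrite [a + delta - c]addrAC [a - delta - c]addrAC.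
by rewrite key lexx /= -key lexx.
Qed.

Let measurable_center : measurable_fun setT center.
Proof.
apply: (measurability _ (RGenOInfty.measurableE R)) => // _ [_ [a ->] <-].
rewrite setTI (_ : _ @^-1` _ = [set x |
  loglik lambda x (a - delta) < loglik lambda x (a + delta)]); last first.
  by apply/seteqP; split=> x /=; rewrite in_itv /= andbT !ltNge center_le.
rewrite -[X in measurable X]setTI.
have mL t : measurable_fun setT (fun x : n.-tuple borelR => loglik lambda x t).
  exact: (measurableT_comp (@measurable_loglik R lambda n mlambda) (measurable_pair2 t)).
exact: (@measurable_fun_ltr _ _ _ setT).
Qed.

#[local] HB.instance Definition _ :=
  isMeasurableFun.Build _ _ _ _ center measurable_center.

(** The likelihood at both ends of the window around [center x] is the constant of
    the bathtub argument. *)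
Lemma center_window (x : n.-tuple borelR) (t : R) :
  (\int[lebesgue_measure]_(theta in [set theta : borelR | (`|t - theta| < delta)%R])
     (expR (loglik lambda x theta - loglik lambda x 0))%:E <=
   \int[lebesgue_measure]_(theta in
       [set theta : borelR | (`|center x - theta| < delta)%R])
     (expR (loglik lambda x theta - loglik lambda x 0))%:E)%E.
Proof.
have lt : center x - delta < center x + delta by rewrite ltrD2l gtrN.
have mL := @measurable_loglik R lambda n mlambda.
apply: (@bathtub_window R _ delta
  (expR (loglik lambda x (center x - delta) - loglik lambda x 0)) (center x)) => //.
- apply: measurableT_comp => //; apply: measurable_funB => //.
  exact: (measurableT_comp mL (measurable_pair1 x)).
- move=> y; rewrite distrC ltr_distl => /andP[ya yb]; rewrite ler_expR lerD2r.
  apply: (concave_level_inside (is_derive_loglik hd x)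
    (@dloglik_nonincreasing x) (center_level x)).
  by rewrite !ltW.
- move=> y; rewrite distrC leNgt ltr_distl negb_and -!leNgt => hy.
  rewrite ler_expR lerD2r.
  apply: (concave_level_outside (is_derive_loglik hd x)
    (@dloglik_nonincreasing x) lt (center_level x)).
  exact/orP.
Qed.

Lemma center_error (theta : R) (A : set borelR) : measurable A ->
  prob_power (shifted mu theta) n [set x | A (center x - theta)] =
  prob_power mu n [set x | A (center x)].
Proof.
move=> mA; have preE : @shift_tuple R n theta @^-1` [set x | A (center x - theta)] =
    [set x | A (center x)].
  by apply/seteqP; split=> x /=; rewrite center_shift addrK.
rewrite prob_power_shifted ?preE//; last first.
  by rewrite -[X in measurable X]setTI; exact: measurable_center.
rewrite -[X in measurable X]setTI.
apply: (_ : measurable_fun setT (fun x => center x - theta)) => //.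
exact: measurable_funB.
Qed.

Lemma optimal_shift_invariant :
  exists e : estimator R n, shift_invariant e /\ optimal mu delta e.
Proof.
exists center; split=> [c x|e']; first exact: center_shift.
pose p (z : n.-tuple borelR * borelR) : R :=
  expR (loglik lambda z.1 z.2 - loglik lambda z.1 0).
pose P theta := prob_power (shifted mu theta) n.
pose Q := prob_power mu n.
have mL := @measurable_loglik R lambda n mlambda.
have mp : measurable_fun setT p.
  apply: measurableT_comp => //; apply: measurable_funB => //.
  have mL0 := measurableT_comp mL (measurable_pair2 (0 : R)).
  exact: (measurableT_comp mL0).
have qE theta : P theta [set x | `|center x - theta| < delta] =
    Q [set x | `|center x| < delta].
  apply: (center_error theta (A := [set t : borelR | `|t| < delta])).
  exact: measurable_norm_lt.
have -> : quality mu delta (center : estimator R n) =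
    Q [set x | `|center x| < delta].
  rewrite /quality; apply/eqP; rewrite eq_le; apply/andP; split.
    by rewrite -(qE 0); apply: ereal_inf_lbound; exists 0.
  by apply: le_ereal_inf_tmp => _ [theta _ <-]; rewrite -(qE theta).
have le theta : (quality mu delta e' <= P theta [set x | (`|e' x - theta| < delta)%R])%E.
  by apply: ereal_inf_lbound; exists theta.
have fin : quality mu delta e' \is a fin_num.
  rewrite ge0_fin_numE; last by apply: le_ereal_inf_tmp => _ [theta _ <-].
  apply: le_lt_trans (le 0) _; apply: le_lt_trans (ltry 1).
  by apply: probability_le1; exact: measurable_error_lt.
rewrite -(fineK fin).
apply: (@worst_hit_prob_le R _ _ P Q p delta mp _ _ hdelta center e') => //.
- by move=> z; exact: expR_ge0.
- by move=> theta A mA; exact: prob_power_shifted_density.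
- by move=> x; exact: center_window.
- exact: center_error.
- by move=> theta; rewrite fineK.
Qed.

End log_concave_density.

Unset Implicit Arguments.

Theorem mainTheorem3 (R : realType) (delta : R) (hdelta : 0 < delta)
    (mu : probability (measurableTypeR R) R) (lambda : R -> R)
    (hderivable : forall x : R, derivable lambda x 1)
    (hcontinuous : continuous (derive1 lambda))
    (hdecreasing : nonincreasing_fun (derive1 lambda))
    (hmu : has_density mu (fun x => expR (lambda x)))
    (n : nat) (hn : (1 <= n)%N) :
  exists e : estimator R n, shift_invariant e /\ optimal mu delta e.
Proof. exact: (optimal_shift_invariant hderivable hdecreasing hmu hn hdelta). Qed.
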